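(* Let $\mu\in\mathcal P$ and $n\in\mathbb N$. There exists a best $d_{\sf K}$-approximation $\delta_\bullet^{\bullet,n}$ of $\mu$, and $d_{\sf K}(\mu,\delta_\bullet^{\bullet,n})={\sf K}_\bullet^{\bullet,n}$. Moreover, for every $x\in\Xi_n$ and $p\in\Pi_n$, the following are equivalent: (i) $d_{\sf K}(\mu,\delta_x^p)=d_{\sf K}(\mu,\delta_\bullet^{\bullet,n})$; (ii) for every $j=0,\ldots,n$: $x_j<x_{j+1}\ \Longrightarrow\ F_{\mu-}(x_{j+1})-{\sf K}_\bullet^{\bullet,n}\le P_j\le F_\mu(x_j)+{\sf K}_\bullet^{\bullet,n}$; (iii) for every $j=1,\ldots,n$: $P_{j-1}<P_j\ \Longrightarrow\ F_{\mu-}^{-1}(P_j-{\sf K}_\bullet^{\bullet,n})\le x_j\le F_\mu^{-1}(P_{j-1}+{\sf K}_\bullet^{\bullet,n})$.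
   Context: $\mathbb I\subset\mathbb R$ is a compact interval with positive Lebesgue measure, and $\mathcal P$ is the set of all Borel probability measures on $\mathbb I$. For $\mu\in\mathcal P$, $F_\mu(x)=\mu(\{y\in\mathbb I:y\le x\})$ for $x\in\mathbb R$. The Kolmogorov distance is $d_{\sf K}(\mu,\nu)=\sup_{x\in\mathbb R}|F_\mu(x)-F_\nu(x)|$. For non-decreasing $f:\mathbb R\to\overline{\mathbb R}=\mathbb R\cup\{\pm\infty\}$, put $f_\pm(x)=\lim_{\varepsilon\downarrow0}f(x\pm\varepsilon)$ for $x\in\mathbb R$, $f_\pm(\pm\infty)=f(\pm\infty):=\lim_{x\to\pm\infty}f(x)$ (same sign for the argument and the limit), and let $f^{-1}:\mathbb R\to\overline{\mathbb R}$, $f^{-1}(t)=\sup\{x\in\mathbb R:f(x)\le t\}$, with $\sup\varnothing=-\infty$ (and $f^{-1}(\pm\infty)=\lim_{t\to\pm\infty}f^{-1}(t)$). Thus $F_\mu^{-1}(t)=-\infty$ for $t<0$ and $F_\mu^{-1}(t)=+\infty$ for $t\ge1$; $F_{\mu-}=(F_\mu)_-$ and $F_{\mu-}^{-1}=(F_\mu^{-1})_-$ denote left limits; $F_\mu(-\infty)=0$, $F_{\mu-}(+\infty)=1$. For $n\in\mathbb N$: $\Xi_n=\{x\in\mathbb I^n:x_1\le\ldots\le x_n\}$, with $x_0:=-\infty$, $x_{n+1}:=+\infty$; $\Pi_n=\{p\in\mathbb R^n:p_j\ge0,\ \sum_{j=1}^np_j=1\}$, with $P_i=\sum_{j=1}^ip_j$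 for $i=0,\ldots,n$ (so $P_0=0$, $P_n=1$); $\delta_x^p=\sum_{j=1}^np_j\delta_{x_j}$, where $\delta_a$ is the Dirac measure at $a$. A best $d_{\sf K}$-approximation of $\mu$ (for given $n$), denoted $\delta_\bullet^{\bullet,n}$, is a measure $\delta_x^p$ with $x\in\Xi_n$, $p\in\Pi_n$ such that $d_{\sf K}(\mu,\delta_x^p)\le d_{\sf K}(\mu,\delta_y^q)$ for all $y\in\Xi_n$, $q\in\Pi_n$. For $a\ge0$ let $S_{f,a}:\overline{\mathbb R}\to\overline{\mathbb R}$, $S_{f,a}(x)=f_+(f^{-1}(x+a))+a$, let $S_{f,a}^{[n]}$ be its $n$-fold composition with itself, and let $${\sf K}_\bullet^{\bullet,n}=\min\{a\ge0:S_{F_\mu,a}^{[n]}(0)\ge1\}$$ (this minimum exists and is finite). *)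

(* Defs.v *)
From HB Require Import structures.
From mathcomp Require Import all_boot all_order all_algebra.
From mathcomp Require Import all_classical all_reals all_analysis.
Import Order.TTheory GRing.Theory Num.Theory.
Import numFieldNormedType.Exports.

Set Implicit Arguments.
Unset Strict Implicit.
Unset Printing Implicit Defensive.

Local Open Scope classical_set_scope.
Local Open Scope ring_scope.
Local Open Scope ereal_scope.

(* A Borel probability measure on the compact interval [a, b] is represented by
   a Borel probability measure [mu] on [R] with [mu `[a, b] = 1]. *)

Section MonotoneFunctions.
Variable R : realType.
Implicit Types (f : R -> \bar R) (x : R) (y : \bar R).

(* [lim] is a genuine limit whenever [f] is non-decreasing, the only case in
   which the notions of this section are used. *)
Definition extend f y : \bar R :=
  match y with
  | x%:E => f x
  | +oo => lim (f x @[x --> +oo%R])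
  | -oo => lim (f x @[x --> -oo%R])
  end.

Definition right_limit f x : \bar R := lim (f (x + e)%R @[e --> 0%R^'+]).
Definition left_limit f x : \bar R := lim (f (x - e)%R @[e --> 0%R^'+]).

(* At [+oo] and [-oo] these take the value of [extend f], not the limit of the
   one-sided limits. *)
Definition right_extend f y : \bar R :=
  if y is x%:E then right_limit f x else extend f y.
Definition left_extend f y : \bar R :=
  if y is x%:E then left_limit f x else extend f y.

(* [ereal_sup set0 = -oo] *)
Definition upper_inverse f (t : R) : \bar R :=
  ereal_sup [set x%:E | x in [set x : R | f x <= t%:E]].

Definition S_map f (a : R) (y : \bar R) : \bar R :=
  right_extend f (extend (upper_inverse f) (y + a%:E)) + a%:E.

End MonotoneFunctions.

Section KolmogorovApproximation.
Variable R : realType.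
Implicit Types (mu nu : set (measurableTypeR R) -> \bar R) (n : nat).

Definition distribution_function mu (x : R) : \bar R := mu [set y | (y <= x)%R].

Definition kolmogorov_dist mu nu : \bar R :=
  ereal_sup [set `|distribution_function mu x - distribution_function nu x|
            | x in [set: R]].

(* In [Xi] and [Pi] the coordinates 1, ..., n are indexed by 0, ..., n - 1. *)
Definition Xi (a b : R) n : set ('I_n -> R) :=
  [set x | (forall i, x i \in `[a, b]%R) /\
           (forall i j : 'I_n, (i <= j)%N -> (x i <= x j)%R)].

Definition Pi n : set ('I_n -> R) :=
  [set p | (forall i, (0 <= p i)%R) /\ (\sum_(i < n) p i = 1)%R].

(* [node x j] is x_j with the original numbering j = 0, ..., n + 1, where
   x_0 = -oo and x_(n+1) = +oo. *)
Definition node n (x : 'I_n -> R) (j : nat) : \bar R :=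
  if j is k.+1 then
    if insub k is Some i then (x i)%:E else +oo
  else -oo.

Definition cumul n (p : 'I_n -> R) (j : nat) : R :=
  (\sum_(i < n | (i < j)%N) p i)%R.

Definition discrete n (x p : 'I_n -> R) : set (measurableTypeR R) -> \bar R :=
  fun A => \sum_(i < n) (p i)%:E * \d_(x i : measurableTypeR R) A.

Definition best_approximation (a b : R) mu n nu : Prop :=
  exists x p : 'I_n -> R,
    [/\ Xi a b x, Pi p, nu = discrete x p &
        forall y q : 'I_n -> R, Xi a b y -> Pi q ->
          kolmogorov_dist mu (discrete x p) <=
          kolmogorov_dist mu (discrete y q)].

Definition admissible_levels mu n : set R :=
  [set a | (0 <= a)%R /\ 1 <= iter n (S_map (distribution_function mu) a) 0].

Definition is_minimum (A : set R) (m : R) : Prop := A m /\ lbound A m.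

End KolmogorovApproximation.

(* Main.v *)
Require Import Defs.
From HB Require Import structures.
From mathcomp Require Import all_boot all_order all_algebra.
From mathcomp Require Import all_classical all_reals all_analysis.
From mathcomp Require Import lra.
Import Order.TTheory GRing.Theory Num.Theory.
Import numFieldNormedType.Exports.
Set Implicit Arguments.
Unset Strict Implicit.
Unset Printing Implicit Defensive.
Local Open Scope classical_set_scope.
Local Open Scope ring_scope.
Local Open Scope ereal_scope.

(** Let [F] be the distribution function of [mu].  The distribution function
    of [discrete x p] equals [P_j], that is [cumul p j], on the gap from [x_j]
    (included) to [x_(j+1)] (excluded).  So it stays within [K] of [F] exactly
    when, on every nonempty gap, [P_j - K] is a lower bound of [F] and
    [P_j + K] an upper bound.  By monotonicity only the two ends of the gap
    matter, and this is condition (ii) ([within_node_condition]).  Reading the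
    same bounds at the atoms instead of on the gaps gives (iii): an atom [x_j]
    must be placed where [F <= P_(j-1) + K] to its left and [F >= P_j - K] from
    it on, and the two inverses of [F] are precisely the ends of the set of
    such places ([within_weight_condition]).

    The second reading also finds the least error.  With error [c], once the
    height [y] is reached, the next atom can be put no further right than the
    quantile [q] of [y + c], and there the step function may rise to at most
    [F q + c].  This greedy step is [S_map F c].  Induction along the atoms
    shows that no approximation of error [c] climbs faster than the greedy one
    ([greedy_height_of_approximation]); conversely the greedy atoms, with
    heights cut at 1, have error at most [c] as soon as [n] greedy steps reach
    height 1 ([approximation_of_greedy_height]).  Hence the admissible levels
    are exactly the nonnegative [c] such that some choice of [n] weighted atoms
    has error at most [c].

    A least one exists because the height after [n] greedy steps depends on [c]
    monotonically and right-continuously ([greedy_height_rc]), so the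
    inequality defining the admissible levels passes to their infimum
    ([min_admissible]).  The theorem then follows: being best means having
    error at most the least level [K], to which both characterizations
    apply. *)

(** * Left limits and inverses of monotone functions *)

Section MonotoneExtended.
Context {R : realType}.
Implicit Types (f : R -> \bar R) (t x : R) (y : \bar R).

(** The left limit of a monotone function is a supremum; in this form it
    serves both for the distribution function and for its inverse. *)
Lemma left_limit_le f x y : {homo f : s t / (s <= t)%R >-> s <= t} ->
  left_limit f x <= y <-> forall t, (t < x)%R -> f t <= y.
Proof.
move=> nd.
have anti : {in `]0%R, +oo[ &, nonincreasing_fun (fun e => f (x - e)%R)}.
  by move=> s t _ _ st; apply: nd; rewrite lerB.
have lim := nonincreasing_at_right_cvge (BInfty R false) isT anti.
rewrite /left_limit (cvg_lim _ lim)//; split=> [le t tx|le].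
  apply: le_trans le; apply: ereal_sup_ubound; exists (x - t)%R => /=.
    by rewrite in_itv/= andbT subr_gt0.
  by rewrite subKr.
apply: ge_ereal_sup => _ [e /= + <-]; rewrite in_itv/= andbT => e0.
by apply: le; rewrite ltrBlDr ltrDl.
Qed.

Lemma upper_inverse_le f x t :
  upper_inverse f t <= x%:E <-> forall z, (x < z)%R -> t%:E < f z.
Proof.
split=> [le z xz|lt].
  rewrite ltNge; apply/negP => fz.
  have : z%:E <= x%:E by apply: le_trans le; apply: ereal_sup_ubound; exists z.
  by rewrite lee_fin leNgt xz.
apply: ge_ereal_sup => _ [z /= fz <-]; rewrite lee_fin leNgt.
by apply/negP => /lt; rewrite ltNge fz.
Qed.

Lemma le_upper_inverse f x t : {homo f : s t / (s <= t)%R >-> s <= t} ->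
  x%:E <= upper_inverse f t <-> forall z, (z < x)%R -> f z <= t%:E.
Proof.
move=> nd; split=> [le z zx|le].
  rewrite leNgt; apply/negP => fz.
  have : x%:E <= z%:E.
    apply: (le_trans le); apply/upper_inverse_le => w zw.
    by apply: lt_le_trans fz _; apply/nd/ltW.
  by rewrite lee_fin leNgt zx.
apply/lee_subgt0Pr => e e0; apply: ereal_sup_ubound; exists (x - e)%R => //=.
by apply: le; rewrite ltrBlDr ltrDl.
Qed.

Lemma upper_inverse_nd f : {homo upper_inverse f : s t / (s <= t)%R >-> s <= t}.
Proof.
move=> s t st; apply: ereal_sup_le => _ [z /= fz <-]; exists z => //=.
by rewrite (le_trans fz)// lee_fin.
Qed.

End MonotoneExtended.

Local Open Scope ring_scope.

(** * Distribution functions carried by a compact interval *)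

(** The last clause is right continuity, one-sided because [F] is monotone. *)
Definition cdf_on {R : realType} (a b : R) (F : R -> R) : Prop :=
  [/\ {homo F : s t / s <= t}, forall t, t < a -> F t = 0,
      forall t, b <= t -> F t = 1
    & forall t e, 0 < e -> exists2 d, 0 < d & F (t + d) <= F t + e].

Section Cdf.
Context {R : realType} (a b : R) (F : R -> R).
Hypothesis cF : cdf_on a b F.
Let f : R -> \bar R := EFin \o F.

Lemma cdf_on_ge0 t : 0 <= F t.
Proof.
have [nd F0 _ _] := cF; pose s := Num.min t (a - 1).
have <- : F s = 0 by apply: F0; rewrite gt_min [X in _ || X]ltrBlDr ltrDl ltr01 orbT.
by apply: nd; rewrite ge_min lexx.
Qed.

Lemma cdf_on_le1 t : F t <= 1.
Proof.
have [nd _ F1 _] := cF.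
have <- : F (Num.max t b) = 1 by apply: F1; rewrite le_max lexx orbT.
by apply: nd; rewrite le_max lexx.
Qed.

Lemma cdf_EFin_nd : {homo f : s t / (s <= t)%R >-> (s <= t)%E}.
Proof. by have [nd _ _ _] := cF; move=> s t st; rewrite lee_fin nd. Qed.

Lemma extend_cdf_pinfty : extend f +oo%E = 1%:E.
Proof.
have [_ _ F1 _] := cF; apply: cvg_lim => //; apply: cvg_near_cst.
by exists b; split; rewrite ?num_real// => t /= bt; rewrite /f/= F1// ltW.
Qed.

Lemma extend_cdf_ninfty : extend f -oo%E = 0%:E.
Proof.
have [_ F0 _ _] := cF; apply: cvg_lim => //; apply: cvg_near_cst.
by exists a; split; rewrite ?num_real// => t /= ta; rewrite /f/= F0.
Qed.

Lemma right_limit_cdf x : right_limit f x = (F x)%:E.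
Proof.
have [nd _ _ rc] := cF; apply: cvg_lim => //; apply: cvg_EFin.
  by apply: nearW.
apply/cvgrPdist_le => e e0; have [d d0 Fd] := rc x e e0.
near=> h.
have h0 : 0 < h by near: h; exact: nbhs_right_gt.
have hd : h <= d by near: h; exact: nbhs_right_le.
rewrite /= distrC ger0_norm; last by rewrite subr_ge0 nd// lerDl ltW.
by rewrite lerBlDl (le_trans _ Fd)// nd// lerD2l.
Unshelve. all: by end_near. Qed.

(** With [node x j.+1] for [y], the bound at the right end of a gap becomes a
    bound at the points of the gap; the value 1 at [+oo] makes the last gap,
    unbounded on the right, obey the same rule. *)
Lemma left_extend_le y c : y != -oo%E ->
  (left_extend f y <= c%:E)%E <-> forall t, (t%:E < y)%E -> F t <= c.
Proof.
case: y => [x|_|//].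
  move=> _; rewrite (left_limit_le _ _ cdf_EFin_nd); split => le t.
    by rewrite lte_fin => /le; rewrite lee_fin.
  by move=> tx; rewrite lee_fin le// lte_fin.
have -> : left_extend f +oo%E = 1%:E := extend_cdf_pinfty; rewrite lee_fin.
split=> [c1 t _|le]; first exact: le_trans (cdf_on_le1 t) c1.
by have [_ _ F1 _] := cF; rewrite -(F1 b)// le// ltry.
Qed.

Lemma le_extend y c : y != +oo%E ->
  (c%:E <= extend f y)%E <-> forall t, (y <= t%:E)%E -> c <= F t.
Proof.
have [nd F0 _ _] := cF; case: y => [x|//|_].
  move=> _; rewrite lee_fin; split=> [cx t xt|]; last by apply.
  by apply: le_trans cx _; apply: nd; rewrite -lee_fin.
rewrite extend_cdf_ninfty lee_fin; split=> [c0 t _|le].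
  exact: le_trans c0 (cdf_on_ge0 t).
by rewrite -(F0 (a - 1)) ?le ?leNye// ltrBlDr ltrDl.
Qed.

(** [left_limit (upper_inverse F)] is the lower quantile function, the least
    point where [F] reaches [s]: right continuity puts that point itself among
    those where [s <= F]. *)
Lemma left_inverse_le x s :
  (left_limit (upper_inverse f) s <= x%:E)%E <-> forall t, x <= t -> s <= F t.
Proof.
have [nd _ _ rc] := cF; rewrite (left_limit_le _ _ (@upper_inverse_nd _ f)).
split=> [le t xt|le u us].
  suff sx : s <= F x by apply: le_trans sx _; exact: nd.
  apply/ler_addgt0Pr => e e0.
  have e2 : 0 < e / 2 by rewrite divr_gt0.
  have [d d0 Fd] := rc x _ e2.
  have /le/upper_inverse_le/(_ (x + d)) : s - e / 2 < s by rewrite ltrBlDr ltrDl.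
  by rewrite ltrDl lte_fin => /(_ d0); lra.
apply/upper_inverse_le => z xz; rewrite lte_fin.
by apply: lt_le_trans us _; apply/le/ltW.
Qed.

Lemma le_inverse x s :
  (x%:E <= upper_inverse f s)%E <-> forall t, t < x -> F t <= s.
Proof.
rewrite (le_upper_inverse _ _ cdf_EFin_nd).
by split=> le t /le; rewrite lee_fin.
Qed.

(** * The greedy step *)

(** The cut at [b] keeps the quantile real, and inside the interval, for
    [1 <= t], where the inverse is [+oo]; as [F b = 1], the value of [F] there
    does not change. *)
Definition quantile t : R := fine (Order.min (upper_inverse f t) b%:E).

Lemma quantileE t : 0 <= t -> (quantile t)%:E = Order.min (upper_inverse f t) b%:E.
Proof.
move=> t0; have [_ F0 _ _] := cF.
have ge_a : (a%:E <= upper_inverse f t)%E.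
  by apply/le_inverse => s sa; rewrite F0.
rewrite fineK// fin_numElt gt_min lt_min.
by rewrite (lt_le_trans _ ge_a) ?ltNyr//= ltry orbT.
Qed.

Lemma le_quantile x t : 0 <= t ->
  x <= quantile t <-> x <= b /\ forall s, s < x -> F s <= t.
Proof.
move=> t0; rewrite -lee_fin quantileE// le_min lee_fin.
split=> [/andP[/le_inverse ? ?]//|[-> /le_inverse ->]//].
Qed.

Lemma quantile_mem t : a <= b -> 0 <= t -> quantile t \in `[a, b].
Proof.
move=> ab t0; have [_ F0 _ _] := cF; rewrite in_itv/=; apply/andP; split.
  by apply/le_quantile => //; split=> // s sa; rewrite F0.
by have /le_quantile [] := lexx (quantile t).
Qed.

Lemma quantile_nd s t : 0 <= s -> s <= t -> quantile s <= quantile t.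
Proof.
move=> s0 st; have t0 := le_trans s0 st.
have /(le_quantile _ s0)[qb Fs] := lexx (quantile s).
by apply/le_quantile => //; split=> // u /Fs us; exact: le_trans us st.
Qed.

Lemma right_extend_inverse t : 0 <= t ->
  right_extend f (upper_inverse f t) = (F (quantile t))%:E.
Proof.
move=> t0; have [_ F0 F1 _] := cF; have := quantileE t0.
case E: (upper_inverse f t) => [z| |].
- rewrite -EFin_min => -[->]; rewrite [LHS]right_limit_cdf; congr EFin.
  by case: (leP z b) => // /ltW bz; rewrite !F1.
- by rewrite min_r ?leey// => -[->]; rewrite F1//; exact: extend_cdf_pinfty.
- by rewrite min_l ?leNye.
Qed.

Definition greedy_step c y : R := F (quantile (y + c)) + c.

Lemma S_map_cdf c y : 0 <= y + c -> S_map f c y%:E = (greedy_step c y)%:E.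
Proof. by move=> yc0; rewrite /S_map /= right_extend_inverse// EFinD. Qed.

(** Just to the right of the quantile [q] of [t], [F] exceeds [t] unless
    [q = b], by maximality of [q], and is close to [F q], by right continuity.
    So levels slightly above [t] have their quantiles there too. *)
Lemma cdf_quantile_rc t e : 0 <= t -> 0 < e ->
  exists2 d, 0 < d & F (quantile (t + d)) <= F (quantile t) + e.
Proof.
move=> t0 e0; have [nd _ F1 rc] := cF.
have [h h0] := rc (quantile t) e e0; set z := _ + h => Fz.
have [Fzt|tFz] := leP (F z) t.
  (* a point beyond the quantile where F is still at most t lies beyond b *)
  have bz : b < z.
    rewrite ltNge; apply/negP => zb.
    have : z <= quantile t.
      apply/le_quantile => //; split=> // s /ltW/nd; by move=> ?; lra.
    by rewrite gerDl leNgt h0.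
  exists 1 => //; apply: le_trans Fz.
  by rewrite (F1 z) ?cdf_on_le1// ltW.
exists ((F z - t) / 2); first by rewrite divr_gt0 ?subr_gt0.
set t' := t + _; have t'z : t' < F z by rewrite /t'; lra.
apply: le_trans Fz; apply: nd; rewrite leNgt; apply/negP => zq.
have t'0 : 0 <= t' by rewrite /t'; lra.
have /(le_quantile _ t'0)[_ /(_ _ zq)] := lexx (quantile t').
by lra.
Qed.

Definition greedy_height c j : R := iter j (greedy_step c) 0.

Lemma greedy_height_ge0 c j : 0 <= c -> 0 <= greedy_height c j.
Proof. by move=> c0; case: j => //= j; rewrite addr_ge0 ?cdf_on_ge0. Qed.

Lemma greedy_step_le c c' y y' : 0 <= y + c -> c <= c' -> y <= y' ->
  greedy_step c y <= greedy_step c' y'.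
Proof.
move=> yc0 cc yy; have [nd _ _ _] := cF.
by rewrite lerD// nd// quantile_nd// lerD.
Qed.

Lemma greedy_height_le c c' j : 0 <= c -> c <= c' ->
  greedy_height c j <= greedy_height c' j.
Proof.
move=> c0 cc; elim: j => //= j IH; apply: greedy_step_le => //.
by rewrite addr_ge0// greedy_height_ge0.
Qed.

Lemma greedy_height_leS c j : 0 <= c -> greedy_height c j <= greedy_height c j.+1.
Proof.
move=> c0; elim: j => [|j IH]; first exact: greedy_height_ge0.
by apply: greedy_step_le => //; rewrite addr_ge0// greedy_height_ge0.
Qed.

Lemma iter_S_map c j : (0 <= c) -> iter j (S_map f c) 0%:E = (greedy_height c j)%:E.
Proof.
move=> c0; elim: j => //= j ->; rewrite S_map_cdf//.
by rewrite addr_ge0// greedy_height_ge0.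
Qed.

(** Composing right-continuous non-decreasing functions preserves right
    continuity; here [c] also enters each step directly. *)
Lemma greedy_height_rc c j e : 0 <= c -> 0 < e ->
  exists2 d, 0 < d & greedy_height (c + d) j <= greedy_height c j + e.
Proof.
move=> c0; elim: j e => [|j IH] e e0; first by exists 1 => //=; rewrite add0r ltW.
have e2 : 0 < e / 2 by rewrite divr_gt0.
have t0 : 0 <= greedy_height c j + c by rewrite addr_ge0// greedy_height_ge0.
have [d1 d10 q1] := cdf_quantile_rc t0 e2.
have d12 : 0 < d1 / 2 by rewrite divr_gt0.
have [d2 d20 q2] := IH _ d12.
pose d := Num.min d2 (Num.min (d1 / 2) (e / 2)).
have d0 : 0 < d by rewrite !lt_min d20 d12 e2.
exists d => //; rewrite /= /greedy_step.
have dd2 : d <= d2 by rewrite ge_min lexx.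
have dd1 : d <= d1 / 2 by rewrite !ge_min lexx orbT.
have de : d <= e / 2 by rewrite !ge_min lexx !orbT.
have lcd : greedy_height (c + d) j <= greedy_height (c + d2) j.
  by apply: greedy_height_le; rewrite ?lerD2l// addr_ge0// ltW.
have [nd _ _ _] := cF.
have le1 : F (quantile (greedy_height (c + d) j + (c + d)))
    <= F (quantile (greedy_height c j + c + d1)).
  apply/nd/quantile_nd; last by lra.
  by rewrite addr_ge0 ?greedy_height_ge0// addr_ge0// ltW.
by lra.
Qed.

(** Each greedy step ends at a height of at least [c], so the level 1 is
    admissible.  At the infimum, a height short of 1 would by right continuity
    stay short of 1 at the admissible levels close above. *)
Lemma min_admissible n : (0 < n)%N ->
  exists K, is_minimum [set c | 0 <= c /\ 1 <= greedy_height c n] K.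
Proof.
move=> n0; set A := [set _ | _].
have A1 : A 1.
  by split=> //; rewrite -(prednK n0) /= lerDr cdf_on_ge0.
have lbA : lbound A 0 by move=> c [].
have hiA : has_inf A by split; [exists 1|exists 0].
exists (inf A); split; last by move=> c Ac; apply: ge_inf => //; exists 0.
have K0 : 0 <= inf A by apply: lb_le_inf => //; exists 1.
split=> //; rewrite leNgt; apply/negP => lt1.
have e0 : 0 < (1 - greedy_height (inf A) n) / 2 by rewrite divr_gt0// subr_gt0.
have [d d0 le] := greedy_height_rc n K0 e0.
have [c [c0 c1] cd] := inf_adherent d0 hiA.
have := greedy_height_le n c0 (ltW cd); lra.
Qed.

End Cdf.

(** * Step functions *)

Lemma cumulS {R : realType} n (p : 'I_n -> R) (j : 'I_n) :
  cumul p j.+1 = cumul p j + p j.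
Proof.
rewrite /cumul (bigD1 j) ?ltnSn//= addrC; congr (_ + _).
by apply: eq_bigl => i; rewrite ltnS ltn_neqAle andbC.
Qed.

Section Discrete.
Context {R : realType} (a b : R) (n : nat) (x p : 'I_n -> R).
Hypotheses (xX : Xi a b x) (pP : Pi p).

Definition step_cdf t : R := \sum_(i < n | x i <= t) p i.

Lemma sum_weights_le (P Q : pred 'I_n) : (forall i, P i -> 0 < p i -> Q i) ->
  \sum_(i | P i) p i <= \sum_(i | Q i) p i.
Proof.
have [p0 _] := pP; move=> PQ; rewrite [leLHS]big_mkcond [leRHS]big_mkcond.
apply: ler_sum => i _; case: ifP => [Pi|_]; last by case: ifP.
have [pi|] := ltP 0 (p i); first by rewrite (PQ i).
by move=> /le_trans; apply; case: ifP.
Qed.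

Lemma cumul_n : cumul p n = 1.
Proof.
have [_ <-] := pP; rewrite /cumul; apply: eq_bigl => i.
by rewrite ltn_ord.
Qed.

Lemma node_ord (i : 'I_n) : node x i.+1 = (x i)%:E.
Proof. by rewrite /node valK. Qed.

Lemma node_pinfty j : (n <= j)%N -> node x j.+1 = +oo%E.
Proof. by move=> nj; rewrite /node insubF// ltnNge nj. Qed.

(** When consecutive nodes coincide, the step function jumps over [cumul p j].
    Bounding it on either side of a node, here and in the next lemma, rather
    than evaluating it on a gap, covers that case too: an error of at most [K]
    then gives the bounds of (ii) and of (iii) for every [j]. *)
Lemma step_cdf_le_cumul j t : (t%:E < node x j.+1)%E -> step_cdf t <= cumul p j.
Proof.
have [_ xnd] := xX; move=> tj; apply: sum_weights_le => i xit _.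
rewrite ltnNge; apply/negP => ji.
have jn := leq_ltn_trans ji (ltn_ord i).
move: tj; rewrite -[j]/(nat_of_ord (Ordinal jn)) node_ord lte_fin ltNge.
by rewrite (le_trans _ xit)// xnd.
Qed.

Lemma cumul_le_step_cdf j t : (node x j <= t%:E)%E -> cumul p j <= step_cdf t.
Proof.
have [_ xnd] := xX; move=> jt; apply: sum_weights_le => i + _.
case: j jt => // j + ij; have [jn|nj] := ltnP j n.
  rewrite -[j]/(nat_of_ord (Ordinal jn)) node_ord lee_fin.
  by apply: le_trans; apply: xnd; rewrite -ltnS.
by rewrite node_pinfty// leye_eq.
Qed.

Lemma exists_gap t : exists2 j, (j <= n)%N & (node x j <= t%:E < node x j.+1)%E.
Proof.
have ex : exists j, (t%:E < node x j.+1)%E.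
  by exists n; rewrite node_pinfty// ltry.
case: (ex_minnP ex) => j tj min_j; exists j.
  by apply: min_j; rewrite node_pinfty// ltry.
rewrite tj andbT; case: j tj min_j => [|j] tj min_j; first exact: leNye.
by rewrite leNgt; apply/negP => /min_j; rewrite ltnn.
Qed.

(** * The two characterizations of a given error *)

Variable F : R -> R.
Hypothesis cF : cdf_on a b F.
Variable K : R.
Hypothesis K0 : 0 <= K.
Let f : R -> \bar R := EFin \o F.

Definition within (G : R -> R) := forall t, `|F t - G t| <= K.

(** Sufficiency uses the gap containing [t]: the step function is constant on
    it, and monotonicity of [F] carries the bounds at its ends to [t]. *)
Lemma within_node_condition :
  within step_cdf <->
  forall j, (j <= n)%N -> (node x j < node x j.+1)%E ->
    (left_extend f (node x j.+1) - K%:E <= (cumul p j)%:E)%E /\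
    ((cumul p j)%:E <= extend f (node x j) + K%:E)%E.
Proof.
have node_Ny j : node x j.+1 != -oo%E.
  by have [jn|nj] := ltnP j n; rewrite ?(node_ord (Ordinal jn))// node_pinfty.
have node_y j : (j <= n)%N -> node x j != +oo%E.
  by case: j => // j jn; rewrite (node_ord (Ordinal jn)).
split=> [FG j jn _|cond t].
  rewrite leeBlDr// -EFinD (left_extend_le cF)//.
  rewrite -leeBlDr// -EFinB (le_extend cF) ?node_y//; split=> t tj.
    have := step_cdf_le_cumul tj; have := FG t; rewrite ler_norml; lra.
  have := cumul_le_step_cdf tj; have := FG t; rewrite ler_norml; lra.
have [j jn /andP[jt tj]] := exists_gap t.
have [] := cond j jn (le_lt_trans jt tj).
rewrite leeBlDr// -EFinD (left_extend_le cF)// => /(_ t tj) loF.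
rewrite -leeBlDr// -EFinB (le_extend cF) ?node_y// => /(_ t jt) hiF.
have := cumul_le_step_cdf jt; have := step_cdf_le_cumul tj.
by rewrite ler_norml; lra.
Qed.

(** For sufficiency, compare at [t] with the nearest atoms of positive weight:
    the first one after [t] bounds [F t] from above, the last one up to [t]
    bounds it from below.  If there is none, the step function is 1 or 0
    at [t]. *)
Lemma within_weight_condition :
  within step_cdf <->
  forall j : 'I_n, cumul p j < cumul p j.+1 ->
    (left_limit (upper_inverse f) (cumul p j.+1 - K) <= (x j)%:E)%E /\
    ((x j)%:E <= upper_inverse f (cumul p j + K))%E.
Proof.
split=> [FG j _|cond t].
  rewrite (left_inverse_le cF) (le_inverse cF); split=> t tj.
    have : (node x j.+1 <= t%:E)%E by rewrite node_ord lee_fin.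
    by move/cumul_le_step_cdf; have := FG t; rewrite ler_norml; lra.
  have : (t%:E < node x j.+1)%E by rewrite node_ord lte_fin.
  by move/step_cdf_le_cumul; have := FG t; rewrite ler_norml; lra.
have {}cond (j : 'I_n) : 0 < p j ->
    (forall s, x j <= s -> cumul p j.+1 <= F s + K) /\
    (forall s, s < x j -> F s <= cumul p j + K).
  move=> pj; have /cond[] : cumul p j < cumul p j.+1.
    by rewrite cumulS ltrDl.
  move=> /(left_inverse_le cF) Fl /(le_inverse cF) Fr.
  by split=> // s /Fl; rewrite lerBlDr.
have lo : F t <= step_cdf t + K.
  case: (pickP [pred i | (0 < p i) && (t < x i)]) => [i0 Pi0|none].
    case: (arg_minnP (@nat_of_ord n) Pi0) => i /andP[pi ti] min_i.
    have [_ /(_ t ti)] := cond i pi.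
    suff : cumul p i <= step_cdf t by lra.
    apply: sum_weights_le => k ki pk; rewrite leNgt; apply/negP => tk.
    by have := min_i k; rewrite /= pk tk leqNgt ki => /(_ isT).
  apply: le_trans (cdf_on_le1 cF t) _; rewrite -cumul_n.
  apply: ler_wpDr => //; apply: sum_weights_le => i _ pi.
  by have := none i; rewrite /= pi/= leNgt => ->.
have hi : step_cdf t <= F t + K.
  case: (pickP [pred i | (0 < p i) && (x i <= t)]) => [i0 Pi0|none].
    case: (arg_maxnP (@nat_of_ord n) Pi0) => i /andP[pi ti] max_i.
    have [/(_ t ti) + _] := cond i pi.
    suff : step_cdf t <= cumul p i.+1 by lra.
    apply: sum_weights_le => k kt pk.
    by rewrite ltnS; apply: max_i; rewrite /= pk kt.
  apply: (@le_trans _ _ 0); last by rewrite addr_ge0// (cdf_on_ge0 cF).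
  rewrite -(big_pred0_eq 0 +%R (index_enum 'I_n) p).
  apply: sum_weights_le => i ti pi.
  by have := none i; rewrite /= pi ti.
by rewrite ler_norml; lra.
Qed.

End Discrete.

(** * The least error of n atoms *)

Section Optimum.
Context {R : realType} (a b : R) (F : R -> R) (n : nat) (c : R).
Hypotheses (cF : cdf_on a b F) (c0 : 0 <= c).

(** Greed is optimal: an [i]-th atom with error [c] lies at most at the greedy
    quantile, since [F] to its left is at most the previous height plus [c]. *)
Lemma greedy_height_of_approximation (x p : 'I_n -> R) : Xi a b x -> Pi p ->
  within F c (step_cdf x p) -> 1 <= greedy_height b F c n.
Proof.
move=> xX pP FG; have [nd _ _ _] := cF.
rewrite -(cumul_n pP).
suff le j : (j <= n)%N -> cumul p j <= greedy_height b F c j by exact: le.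
elim: j => [|j IH] jn; first by rewrite /cumul big1.
have {}IH := IH (ltnW jn); pose i := Ordinal jn.
have t0 : 0 <= greedy_height b F c j + c by rewrite addr_ge0 ?(greedy_height_ge0 cF).
have xq : x i <= quantile b F (greedy_height b F c j + c).
  apply/(le_quantile cF) => //; split.
    by have [/(_ i)] := xX; rewrite in_itv/= => /andP[].
  move=> s si; have : (s%:E < node x i.+1)%E by rewrite node_ord lte_fin.
  move/(step_cdf_le_cumul xX pP); have := FG s; rewrite ler_norml/=; lra.
have : (node x i.+1 <= (x i)%:E)%E by rewrite node_ord.
move/(cumul_le_step_cdf xX pP) => /=; have := FG (x i); have := nd _ _ xq.
by rewrite ler_norml /greedy_step; lra.
Qed.

(** The greedy atoms satisfy the bounds of (iii) by construction.  Cutting the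
    heights at 1 makes the increments weights of total mass 1, and is harmless
    because [F <= 1]. *)
Lemma approximation_of_greedy_height : a <= b -> 1 <= greedy_height b F c n ->
  exists x p : 'I_n -> R, [/\ Xi a b x, Pi p & within F c (step_cdf x p)].
Proof.
move=> ab lev1; have [nd _ _ _] := cF.
pose t j := greedy_height b F c j + c.
have t0 j : 0 <= t j by rewrite addr_ge0 ?(greedy_height_ge0 cF).
pose P j := Num.min (greedy_height b F c j) 1.
pose x (i : 'I_n) := quantile b F (t i); pose p (i : 'I_n) := P i.+1 - P i.
have levnd j : greedy_height b F c j <= greedy_height b F c j.+1.
  by exact: greedy_height_leS cF _ _ c0.
have PS j : P j <= P j.+1.
  by rewrite le_min ge_min levnd ge_min lexx orbT.
have cP j : (j <= n)%N -> cumul p j = P j.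
  elim: j => [|j IH] jn.
    by rewrite /cumul big1// /P min_l.
  by rewrite -[j]/(nat_of_ord (Ordinal jn)) cumulS/= IH ?(ltnW jn)// /p subrKC.
have pP : Pi p.
  split=> [i|]; first by rewrite subr_ge0.
  transitivity (cumul p n); last by rewrite cP// /P min_r.
  by apply: eq_bigl => i; rewrite ltn_ord.
have tnd (i j : nat) : (i <= j)%N -> t i <= t j.
  move=> ij; rewrite lerD2r; elim: j ij => [|j IH]; first by rewrite leqn0 => /eqP ->.
  rewrite leq_eqVlt => /orP[/eqP -> //|/IH le]; exact: le_trans le (levnd j).
have xX : Xi a b x.
  split=> [i|i j ij]; first exact: (quantile_mem cF).
  by apply: (quantile_nd cF) => //; exact: tnd.
exists x, p; split=> //; apply/(within_weight_condition xX pP cF c0) => j _.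
rewrite (left_inverse_le cF) (le_inverse cF) !cP// ?(ltnW (ltn_ord j))//.
split=> s sj.
  rewrite lerBlDr; apply: (@le_trans _ _ (greedy_height b F c j.+1)).
    by rewrite ge_min lexx.
  by rewrite /= lerD2r nd.
have /(le_quantile cF _ (t0 j))[_ /(_ s sj) Fs] := lexx (x j).
rewrite /P; case: (leP (greedy_height b F c j) 1) => _; first exact: Fs.
by apply: le_trans (cdf_on_le1 cF s) _; rewrite lerDl.
Qed.

End Optimum.

(** * Distribution functions of measures *)

Section Kolmogorov.
Context {R : realType} (mu : probability (measurableTypeR R) R).

Let measurable_ray (t : R) : measurable [set y : measurableTypeR R | y <= t].
Proof. by rewrite -set_itvNyc; exact: measurable_itv. Qed.

Lemma distribution_functionE :
  distribution_function mu = EFin \o (fine \o distribution_function mu).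
Proof.
by apply/funext => t /=; rewrite fineK// fin_num_measure.
Qed.

Lemma cdf_probability a b : mu `[a, b]%classic = 1%E ->
  cdf_on a b (fine \o distribution_function mu).
Proof.
move=> mu1; set F := _ \o _.
have FE t : (F t)%:E = mu [set y | y <= t].
  by rewrite -[LHS]/((EFin \o F) t) -distribution_functionE.
split.
- move=> s t st; rewrite -lee_fin !FE le_measure ?inE//.
  by move=> y /= /le_trans; exact.
- move=> t ta; apply: EFin_inj; rewrite FE; apply/eqP; rewrite -measure_le0.
  have <- : mu (~` `[a, b]%classic) = 0%E.
    by rewrite probability_setC// mu1 subee.
  apply: le_measure; rewrite ?inE//; first exact: measurableC.
  move=> y /= yt /=; rewrite in_itv/= => /andP[ay _].
  by have := le_lt_trans (le_trans (ay : (a <= y :> R)) yt) ta; rewrite ltxx.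
- move=> t bt; apply: EFin_inj; rewrite FE; apply/eqP; rewrite eq_le.
  rewrite probability_le1//= -mu1; apply: le_measure; rewrite ?inE//.
  by move=> y /=; rewrite in_itv/= => /andP[_ yb]; exact: le_trans bt.
pose idR : measurableTypeR R -> R := idfun.
have mid : measurable_fun setT idR by exact: measurable_id.
pose X : {RV mu >-> R} := HB.pack idR (@isMeasurableFun.Build _ _ _ _ idR mid).
have XE : cdf X = EFin \o F.
  apply/funext => t.
  by rewrite /= FE /cdf /distribution /pushforward preimage_id set_itvNyc.
move=> t e e0; have := @cdf_right_continuous _ _ _ _ X t.
rewrite XE => /(@fine_cvg _ _ _ _ _ (F t)) /cvgrPdist_le /(_ e e0) near_t.
near t^'+ => u.
have tu : t < u by near: u; exact: nbhs_right_gt.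
exists (u - t); rewrite ?subr_gt0// subrKC.
have : `|F t - F u| <= e by near: u; exact: near_t.
by rewrite ler_norml; lra.
Unshelve. all: by end_near. Qed.

Lemma distribution_function_discrete n (x p : 'I_n -> R) t :
  distribution_function (discrete x p) t = (step_cdf x p t)%:E.
Proof.
rewrite /distribution_function /discrete /step_cdf [in RHS]big_mkcond/= -sumEFin.
apply: eq_bigr => i _; rewrite diracE -EFinM; congr EFin.
have -> : (x i \in [set y : R | y <= t]) = (x i <= t).
  by apply/idP/idP; rewrite in_setE.
by case: ifP; rewrite ?mulr1 ?mulr0.
Qed.

Lemma kolmogorov_dist_within n (x p : 'I_n -> R) K :
  (kolmogorov_dist mu (discrete x p) <= K%:E)%E <->
  within (fine \o distribution_function mu) K (step_cdf x p).
Proof.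
have E t : `|distribution_function mu t - distribution_function (discrete x p) t|%E
    = `|(fine \o distribution_function mu) t - step_cdf x p t|%:E.
  by rewrite distribution_function_discrete distribution_functionE.
split=> [le t|le].
  by rewrite -lee_fin -E; apply: le_trans le; apply: ereal_sup_ubound; exists t.
by apply: ge_ereal_sup => _ [t _ <-]; rewrite E lee_fin.
Qed.

End Kolmogorov.

Local Open Scope ereal_scope.

Theorem theorem5p6 (R : realType) (a b : R) (hab : (a < b)%R)
    (mu : probability (measurableTypeR R) R) (hmu : mu `[a, b]%classic = 1)
    (n : nat) (hn : (0 < n)%N) :
  exists K : R,
    is_minimum (admissible_levels mu n) K /\
    (exists nu, best_approximation a b mu n nu) /\
    (forall nu, best_approximation a b mu n nu ->
      kolmogorov_dist mu nu = K%:E /\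
      forall x p : 'I_n -> R, Xi a b x -> Pi p ->
        let F := distribution_function mu in
        let i := kolmogorov_dist mu (discrete x p) = kolmogorov_dist mu nu in
        let ii := forall j : nat, (j <= n)%N ->
          node x j < node x j.+1 ->
          left_extend F (node x j.+1) - K%:E <= (cumul p j)%:E /\
          (cumul p j)%:E <= extend F (node x j) + K%:E in
        let iii := forall j : 'I_n,
          (cumul p j < cumul p j.+1)%R ->
          left_limit (upper_inverse F) (cumul p j.+1 - K)%R <= (x j)%:E /\
          (x j)%:E <= upper_inverse F (cumul p j + K)%R in
        (i <-> ii) /\ (ii <-> iii)).
Proof.
have cF := cdf_probability hmu.
have FE := distribution_functionE mu.
set G := (fine \o _)%R in cF FE.
have levE : admissible_levels mu n =
    [set c | (0 <= c)%R /\ (1 <= greedy_height b G c n)%R].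
  rewrite /admissible_levels FE; apply/seteqP.
  by split=> c [/= c0]; rewrite (iter_S_map cF)// lee_fin.
have [K minK] := min_admissible cF hn.
have [[K0 lev1] lbK] := minK.
exists K; rewrite levE; split=> //.
have lower (x p : 'I_n -> R) : Xi a b x -> Pi p ->
    K%:E <= kolmogorov_dist mu (discrete x p).
  move=> xX pP.
  have d0 : 0%E <= kolmogorov_dist mu (discrete x p).
    by apply: le_trans (ereal_sup_ubound _); last (by exists 0%R); exact: abse_ge0.
  case E : (kolmogorov_dist mu (discrete x p)) d0 => [c| |] // d0.
    rewrite lee_fin; apply: lbK; split=> //.
    apply: (greedy_height_of_approximation cF _ xX pP) => //.
    by apply/kolmogorov_dist_within; rewrite E.
  by rewrite leey.
have [x0 [p0 [xX0 pP0 /kolmogorov_dist_within dist0]]] :=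
  approximation_of_greedy_height cF K0 (ltW hab) lev1.
split.
  exists (discrete x0 p0), x0, p0; split=> // y q yX qP.
  exact: le_trans dist0 (lower y q yX qP).
move=> nu [x1 [p1 [xX1 pP1 -> best1]]].
have distK : kolmogorov_dist mu (discrete x1 p1) = K%:E.
  apply/eqP; rewrite eq_le lower// andbT.
  exact: le_trans (best1 x0 p0 xX0 pP0) dist0.
split=> // x p xX pP F i ii iii.
have iw : i <-> within G K (step_cdf x p).
  rewrite /i distK -kolmogorov_dist_within; split=> [->//|le].
  by apply/eqP; rewrite eq_le le lower.
have wii := within_node_condition xX pP cF K.
have wiii := within_weight_condition xX pP cF K0.
rewrite -/G -FE -/F in wii wiii.
by rewrite /ii /iii -wii -wiii; split.
Qed.
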